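(* Let $\mathbf M,\mathbf X,\mathbf Y$ be real symmetric positive definite $n\times n$ matrices, and let $\mu,\nu$ be the Gaussian measures on $\mathbb R^n$ with zero mean and covariances $\mathbf X$ and $\mathbf Y$ respectively. Define the generalized Wasserstein distance by $$\tilde W^2(\mu,\nu):=\inf_{\mathbf x\sim\mu,\ \mathbf y\sim\nu}\mathbb E\|\mathbf x-\mathbf y\|^2_{\mathbf M^{-1}},$$ the infimum being over all couplings (joint laws) of random vectors $\mathbf x$, $\mathbf y$ with marginal laws $\mu$ and $\nu$. Then $\tilde W^2(\mu,\nu)=d^2_{\rm gbw}(\mathbf X,\mathbf Y)$.
   Context: For $\mathbf v\in\mathbb R^n$, $\|\mathbf v\|_{\mathbf M^{-1}}=\sqrt{\mathbf v^\top\mathbf M^{-1}\mathbf v}$. For a matrix $\mathbf B$ that is a product of two symmetric positive definite matrices, $\mathbf B^{1/2}$ denotes its principal square root (the unique square root with positive eigenvalues). The generalized Bures-Wasserstein (GBW) distance is $$d_{\rm gbw}(\mathbf X,\mathbf Y)=\sqrt{\operatorname{tr}(\mathbf M^{-1}\mathbf X)+\operatorname{tr}(\mathbf M^{-1}\mathbf Y)-2\operatorname{tr}\big((\mathbf X\mathbf M^{-1}\mathbf Y\mathbf M^{-1})^{1/2}\big)}.$$ *)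

(* Defs.v *)
From mathcomp Require Import all_boot all_order all_algebra.
From mathcomp Require Import all_classical all_reals all_analysis.
From mathcomp Require Import complex.

Set Implicit Arguments.
Unset Strict Implicit.
Unset Printing Implicit Defensive.

Import Order.TTheory GRing.Theory Num.Theory.

Local Open Scope classical_set_scope.
Local Open Scope ring_scope.

Section Matrices.
Context (R : realType) (n : nat).
Implicit Types (A B S M X Y : 'M[R]_n) (v : 'cV[R]_n).

Definition quad A v : R := (v^T *m A *m v) 0 0.

Definition sym_posdef A : Prop :=
  A^T = A /\ forall v, v != 0 -> 0 < quad A v.

Definition inv_norm M v : R := Num.sqrt (quad (invmx M) v).

(* The eigenvalues are the complex ones: on [R[i]], [0 < z] says that [z] is
   real and positive. *)
Definition is_principal_sqrt B S : Prop :=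
  S *m S = B /\
  forall z : R[i], eigenvalue (map_mx (real_complex R) S) z -> 0 < z.

(* Junk value [0] when [B] has no principal square root. *)
Definition principal_sqrt B : 'M[R]_n :=
  xget 0 [set S | is_principal_sqrt B S].

Definition dgbw M X Y : R :=
  Num.sqrt (\tr (invmx M *m X) + \tr (invmx M *m Y)
            - 2 * \tr (principal_sqrt (X *m invmx M *m Y *m invmx M))).

End Matrices.

(* As a probability space, R^n is [n.-tuple R] with the sigma-algebra generated
   by the coordinates, i.e. the Borel sets; [colv] moves to column vectors. *)
Notation Rn R n := (n.-tuple (measurableTypeR R)).

Section Gaussian.
Context (R : realType) (n : nat).

Definition colv (x : Rn R n) : 'cV[R]_n := \col_i tnth x i.

Definition coordinate (i : 'I_n) (x : Rn R n) : R := tnth x i.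

Definition linform (u : 'cV[R]_n) (x : Rn R n) : R := (u^T *m colv x) 0 0.

(* The one-dimensional normal law of mean [m] and standard deviation [s]; the
   case [s = 0] is the Dirac mass at [m] and has to be singled out because
   [normal_prob m 0] is the uniform law on [0, 1]. *)
Definition normal_law (m s : R) (A : set (measurableTypeR R)) : \bar R :=
  if s == 0 then dirac m A else normal_prob m s A.

(* Gaussian measures on R^n, possibly degenerate: the law of every linear form
   is normal. *)
Definition gaussian (P : probability (Rn R n) R) : Prop :=
  forall u : 'cV[R]_n, exists m s : R,
    forall A : set (measurableTypeR R), measurable A ->
      pushforward P (linform u) A = normal_law m s A.

Definition has_mean (m : 'cV[R]_n) (P : probability (Rn R n) R) : Prop :=
  forall i, 'E_P[coordinate i]%E = (m i 0)%:E.

Definition has_covariance (S : 'M[R]_n) (P : probability (Rn R n) R) : Prop :=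
  forall i j, covariance P (coordinate i) (coordinate j) = (S i j)%:E.

Definition gaussian_with (m : 'cV[R]_n) (S : 'M[R]_n)
    (P : probability (Rn R n) R) : Prop :=
  [/\ gaussian P, has_mean m P & has_covariance S P].

End Gaussian.

Section Wasserstein.
Context (R : realType) (n : nat).

(* Marginals are compared on measurable sets only: the values of a measure
   elsewhere carry no meaning. *)
Definition coupling (mu nu : probability (Rn R n) R) :
    set (probability (Rn R n * Rn R n)%type R) :=
  [set pi | forall A : set (Rn R n), measurable A ->
     pushforward pi fst A = mu A /\ pushforward pi snd A = nu A].

Definition gen_wasserstein2 (M : 'M[R]_n) (mu nu : probability (Rn R n) R) :
    \bar R :=
  ereal_inf
    [set 'E_pi[fun z => (inv_norm M (colv z.1 - colv z.2) ^+ 2)%R]%E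
       | pi in coupling mu nu].

End Wasserstein.

(* Main.v *)
From HB Require Import structures.
Require Import Defs.
From mathcomp Require Import all_boot all_order all_algebra.
From mathcomp Require Import all_classical all_reals all_analysis.
From mathcomp Require Import complex spectral measurable_realfun ring lra.

(* Put [Q = M^-1]. The Riccati equation [G X G = Q Y Q] has a positive definite
   solution [G] (a geometric mean), and then [X Q Y Q = (X G)^2] where [X G] is
   diagonalizable with positive eigenvalues, so [X G] is the principal square
   root. Lower bound: by Fenchel-Young,
     |x - y|_Q^2 >= <x, (Q - G) x> + <y, (Q - Q G^-1 Q) y>,
   and the expectation of the right-hand side depends on the marginals only.
   Equality holds for [y = M G x], which maps [mu] to [nu]: the image of [mu] has
   the linear forms of the same normal laws as [nu], and these determine the
   measure (Cramer-Wold). *)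

Set Implicit Arguments.
Unset Strict Implicit.
Unset Printing Implicit Defensive.

Import Order.TTheory GRing.Theory Num.Theory.
Import numFieldNormedType.Exports.

Local Open Scope ring_scope.

(** Why one [G] serves both bounds: any positive definite [G] gives a lower bound, with equality on
    the graph of [M G]. The Riccati equation says exactly that this map carries covariance [X] to
    [(M G) X (M G)^T = M Q Y Q M = Y], so the bound is attained by an explicit coupling and no
    compactness argument is required. The obstacle on the measure side is that [gaussian] only
    asserts some normal law for each linear form, with parameters not tied to the mean and
    covariance. They are recovered from the first two moments: the reflection symmetry of the law
    gives [m], and a nonzero second moment of the standard law gives [s ^+ 2]. Cramer-Wold is proved
    without characteristic functions: cosines of linear forms generate, under linear combinations
    and bounded pointwise limits, the indicator of every measurable set. *)

(** * Positive definite matrices, square roots and the Riccati equation *)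

Section PositiveDefinite.
Context (R : realType) (n : nat).
Implicit Types (A B S M X Y : 'M[R]_n) (v : 'cV[R]_n).

(** Over the complex numbers [A] is Hermitian, hence diagonalizable with real spectrum. Real
    matrices similar over the complex numbers are similar over the reals, which yields a real [P],
    though no longer an orthogonal one. *)
Lemma sym_diagonalizable A : A^T = A ->
  exists P, exists D : 'rV[R]_n, P \in unitmx /\ P *m A = diag_mx D *m P.
Proof.
move=> As.
pose c := real_complex R.
pose Ac := map_mx c A.
have creal m1 m2 (B : 'M[R]_(m1,m2)) : map_mx c B \is a realmx.
  by apply/mxOverP => i j; rewrite mxE; apply/complex_realP; exists (B i j).
have Ach : Ac \is hermsymmx.
  apply: realsym_hermsym; last exact: creal.
  apply/is_hermitianmxP; rewrite expr0 scale1r /=.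
  by rewrite map_mx_id // /Ac map_trmx As.
have := hermitian_spectral_diag_real Ach.
have /hermitian_normalmx /orthomx_spectralP := Ach.
set P := spectralmx Ac; set D := spectral_diag Ac => eA rD.
have Pu : P \in unitmx by exact: spectral_unit.
pose D' : 'rV[R]_n := \row_j complex.Re (D 0 j).
have DE : D = map_mx c D'.
  apply/rowP => j; rewrite !mxE; have /mxOverP /(_ 0 j) := rD.
  by move/complex_realP => [k ->].
have sim : similar_in unitmx Ac (map_mx c (diag_mx D')).
  exists P => //=; apply/(similarP Pu).
  by rewrite eA !mulmxA mulmxV // mul1mx map_diag_mx -DE.
have [Pr /=/andP [rP uP] sP] := real_similar sim (creal _ _ _) (creal _ _ _).
pose P' : 'M[R]_n := map_mx (@complex.Re R) Pr.
have PE : Pr = map_mx c P'.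
  apply/matrixP => i j; rewrite !mxE; have /mxOverP /(_ i j) := rP.
  by move/complex_realP => [k ->].
exists P', D'; split; first by move: uP; rewrite PE map_unitmx.
apply: (map_mx_inj (f := c)).
rewrite [LHS]map_mxM [RHS]map_mxM -PE.
by apply/(similarP uP).
Qed.

Lemma quadE A v : quad A v = \sum_i \sum_j A i j * (v i 0 * v j 0).
Proof.
rewrite /quad -mulmxA mxE; apply: eq_bigr => i _; rewrite !mxE big_distrr /=.
by apply: eq_bigr => j _; rewrite mulrCA.
Qed.

Lemma mxtr11 (a : 'M[R]_1) : a^T = a.
Proof. by apply/matrixP => i j; rewrite !ord1 mxE. Qed.

Lemma bilinC A (u v : 'cV[R]_n) : A^T = A ->
  (u^T *m A *m v) 0 0 = (v^T *m A *m u) 0 0.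
Proof.
by move=> As; rewrite -[u^T *m A *m v]mxtr11 !trmx_mul trmxK As mulmxA.
Qed.

Lemma posdef_unit A : sym_posdef A -> A \in unitmx.
Proof.
case=> As Ap; rewrite -unitmx_tr -row_free_unit -kermx_eq0.
apply/eqP/row_matrixP => i; rewrite row0; apply/eqP/negP => /negP H.
have := Ap (row i (kermx A^T))^T; rewrite /quad trmxK -trmx_eq0 trmxK => /(_ H).
rewrite As in H *.
have -> : row i (kermx A) *m A = 0 by rewrite -row_mul mulmx_ker row0.
by rewrite mul0mx mxE ltxx.
Qed.

Lemma quad_congr A B v : quad (B^T *m A *m B) v = quad A (B *m v).
Proof. by rewrite /quad trmx_mul !mulmxA. Qed.

Lemma posdef_congr A B : B \in unitmx -> sym_posdef A ->
  sym_posdef (B^T *m A *m B).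
Proof.
move=> Bu [As Ap]; split; first by rewrite !trmx_mul trmxK As mulmxA.
move=> v v0; rewrite quad_congr; apply: Ap; apply: contraNneq v0 => H.
by rewrite -[v](mulKmx Bu) H mulmx0.
Qed.

Lemma posdef1 : sym_posdef (1%:M : 'M[R]_n).
Proof.
split; first exact: trmx1.
move=> v v0; rewrite /quad mulmx1 mxE.
have [i vi] : exists i, v i 0 != 0.
  apply/existsP; apply: contraNT v0 => /existsPn H; apply/eqP/colP => i.
  by rewrite mxE; apply/eqP; rewrite -[_ == _]negbK.
rewrite (bigD1 i) //= ltr_pwDl //.
  by rewrite mxE -expr2 exprn_even_gt0.
by apply: sumr_ge0 => j _; rewrite mxE -expr2 sqr_ge0.
Qed.


Lemma posdef_inv A : sym_posdef A -> sym_posdef (invmx A).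
Proof.
move=> hA; have Au := posdef_unit hA.
have Au' : invmx A \in unitmx by rewrite unitmx_inv.
have := posdef_congr Au' hA; have [As _] := hA.
by rewrite trmx_inv As mulVmx // mul1mx.
Qed.

(** Commuting with [diag_mx D] means that [A i j] vanishes unless [D 0 i = D 0 j], a condition that
    survives applying [f] to the entries. *)
Lemma comm_map_diag A (D : 'rV[R]_n) (f : R -> R) :
  A *m diag_mx D = diag_mx D *m A ->
  A *m diag_mx (map_mx f D) = diag_mx (map_mx f D) *m A.
Proof.
move=> cD; apply/matrixP => i j; move/matrixP/(_ i j): cD.
rewrite !mul_mx_diag !mul_diag_mx !mxE => H.
have [->|aij] := eqVneq (A i j) 0; first by rewrite mulr0 mul0r.
have -> : D 0 i = D 0 j by apply: (mulIf aij); rewrite -H mulrC.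
by rewrite mulrC.
Qed.

(** This replaces the orthogonality of [P]: symmetry of [A] makes [P *m P^T] commute with
    [diag_mx D], hence with its image under [f], and that is the claimed symmetry conjugated by
    [P]. *)
Lemma diagonalized_sym A P (D : 'rV[R]_n) (f : R -> R) : A^T = A ->
  P \in unitmx -> P *m A = diag_mx D *m P ->
  (invmx P *m diag_mx (map_mx f D) *m P)^T =
  invmx P *m diag_mx (map_mx f D) *m P.
Proof.
move=> As Pu e.
have cD : (P *m P^T) *m diag_mx D = diag_mx D *m (P *m P^T).
  have e2 : A *m P^T = P^T *m diag_mx D.
    by rewrite -{1}As -trmx_mul e trmx_mul tr_diag_mx.
  by rewrite -mulmxA -e2 !mulmxA e.
have cfD := comm_map_diag f cD.
have Ptu : P^T \in unitmx by rewrite unitmx_tr.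
apply: (can_inj (mulKmx Pu)); apply: (can_inj (mulmxK Ptu)).
rewrite !trmx_mul tr_diag_mx trmx_inv !mulmxA mulmxV // mul1mx.
by rewrite mulmxKV // cfD mulmxA.
Qed.

Lemma posdef_diagonalizable A : sym_posdef A ->
  exists P, exists D : 'rV[R]_n,
    [/\ P \in unitmx, P *m A = diag_mx D *m P & forall j, 0 < D 0 j].
Proof.
move=> [As Ap]; have [P [D [Pu e]]] := sym_diagonalizable As.
exists P, D; split=> // j.
have rj : row j P *m A = D 0 j *: row j P.
  by rewrite -row_mul e row_mul row_diag_mx -scalemxAl -rowE.
have rn0 : (row j P)^T != 0.
  rewrite trmx_eq0; apply/negP => /eqP H.
  have : (delta_mx 0 j : 'rV[R]_n) *m P *m invmx P = 0.
    by rewrite -rowE H mul0mx.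
  rewrite mulmxK // => /matrixP /(_ 0 j); rewrite !mxE !eqxx => /eqP.
  by rewrite oner_eq0.
have := Ap _ rn0; rewrite /quad trmxK rj -scalemxAl mxE.
have [_ /(_ _ rn0)] := posdef1; rewrite /quad trmxK mulmx1 => rr.
by rewrite pmulr_lgt0.
Qed.

(* Every function of [A] is symmetric, so the square root [invmx P *m sqrt D *m P]
   is a congruence by its own, equally symmetric, square root. *)
Lemma posdef_sqrt A : sym_posdef A -> exists2 S, sym_posdef S & S *m S = A.
Proof.
move=> hA; have [As _] := hA.
have [P [D [Pu e D0]]] := posdef_diagonalizable hA.
pose F (f : R -> R) := invmx P *m diag_mx (map_mx f D) *m P.
have FM f g : F f *m F g = F (fun x => f x * g x).
  rewrite /F -!mulmxA; congr (_ *m _); rewrite !mulmxA mulmxK //.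
  congr (_ *m _); rewrite mul_diag_mx; apply/matrixP => i j; rewrite !mxE.
  by case: eqP => _; rewrite ?mulr1n // !mulr0n mulr0.
have Fs f : (F f)^T = F f by exact: (diagonalized_sym f As Pu e).
have FA : F id = A.
  rewrite /F (_ : map_mx id D = D) ?map_mx_id //.
  by rewrite -mulmxA -e mulKmx.
have eqF f g : (forall j, f (D 0 j) = g (D 0 j)) -> F f = F g.
  by move=> fg; congr (_ *m diag_mx _ *m _); apply/rowP => j; rewrite !mxE fg.
have sq x : 0 < x -> Num.sqrt x * Num.sqrt x = x.
  by move=> x0; rewrite -expr2 sqr_sqrtr // ltW.
exists (F Num.sqrt); last by rewrite FM -[RHS]FA; apply: eqF => j; rewrite sq.
pose T := F (fun x => Num.sqrt (Num.sqrt x)).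
have TT : T^T *m 1%:M *m T = F Num.sqrt.
  by rewrite mulmx1 Fs FM; apply: eqF => j; rewrite sq // sqrtr_gt0.
rewrite -TT; apply: posdef_congr; last exact: posdef1.
have : A \in unitmx by exact: posdef_unit.
rewrite -FA (eqF id (fun x => Num.sqrt x * Num.sqrt x)) => [|j]; last by rewrite sq.
by rewrite -FM -TT mulmx1 !unitmx_mul => /andP[/andP[]].
Qed.

(** With [H] the square root of [X] and [Z] that of [H A H], the solution is [G = H^-1 Z H^-1], the
    geometric mean of [X^-1] and [A]. Then [X G = H Z H^-1] is not symmetric in general but is
    similar to the positive definite [Z]. *)
Lemma posdef_riccati X A : sym_posdef X -> sym_posdef A ->
  exists G, [/\ sym_posdef G, G *m X *m G = A &
    exists P, exists D : 'rV[R]_n,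
    [/\ P \in unitmx, P *m (X *m G) = diag_mx D *m P & forall j, 0 < D 0 j]].
Proof.
move=> hX hA; have [H hH HH] := posdef_sqrt hX.
have [Hs _] := hH; have Hu := posdef_unit hH.
have [Z hZ ZZ] := posdef_sqrt (posdef_congr Hu hA).
have [Vs _] := posdef_inv hH.
have Vu : invmx H \in unitmx by rewrite unitmx_inv.
exists (invmx H *m Z *m invmx H); split.
- by have := posdef_congr Vu hZ; rewrite Vs.
- rewrite -HH !mulmxA mulmxKV // mulmxK //.
  by rewrite -(mulmxA _ Z Z) ZZ Hs !mulmxA mulVmx // mul1mx mulmxK.
have [P [D [Pu e D0]]] := posdef_diagonalizable hZ.
exists (P *m invmx H), D; split => //; first by rewrite unitmx_mul Pu.
by rewrite -HH !mulmxA mulmxKV // mulmxK // e.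
Qed.

Lemma eigenvalue_diagonalized A P (D : 'rV[R]_n) (z : R[i]) :
  P \in unitmx -> P *m A = diag_mx D *m P ->
  eigenvalue (map_mx (real_complex R) A) z -> exists j, z = (D 0 j)%:C%C.
Proof.
move=> Pu e /eigenvalueP [v ev v0].
set c := real_complex R in ev *.
have Pcu : map_mx c P \in unitmx by rewrite map_unitmx.
pose w := v *m invmx (map_mx c P).
have ew : w *m diag_mx (map_mx c D) = z *: w.
  rewrite /w scalemxAl -ev -!mulmxA; congr (_ *m _).
  apply: (can_inj (mulKmx Pcu)); apply: (can_inj (mulmxK Pcu)).
  rewrite mulKVmx // mulmxA mulmxKV // -map_diag_mx.
  by rewrite -[LHS]map_mxM -[RHS]map_mxM e.
have [j wj] : exists j, w 0 j != 0.
  apply/existsP; apply: contraNT v0 => /existsPn H.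
  rewrite -[v](mulmxKV Pcu) -/w; suff -> : w = 0 by rewrite mul0mx.
  by apply/rowP => j; rewrite [RHS]mxE; apply/eqP; rewrite -[_ == _]negbK.
exists j; apply: (mulIf wj).
by move/matrixP/(_ 0 j): ew; rewrite mul_mx_diag !mxE -/w => <-; rewrite mulrC.
Qed.

(** Let [r] be a row of [P], an eigenvector of [A] for [d > 0]. Then
    [(r S - d r) (S + d) = r S^2 - d^2 r = 0], and [S + d] is invertible because [- d] is not an
    eigenvalue of [S]. So [S] and [A] agree on a basis. *)
Lemma principal_sqrt_unique S A P (D : 'rV[R]_n) :
  P \in unitmx -> P *m A = diag_mx D *m P -> (forall j, 0 < D 0 j) ->
  is_principal_sqrt (A *m A) S -> S = A.
Proof.
move=> Pu e D0 [SS Sp].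
apply: (can_inj (mulKmx Pu)); rewrite e; apply/row_matrixP => j.
rewrite row_mul [RHS]row_mul row_diag_mx -scalemxAl -rowE.
have rA : row j P *m A = D 0 j *: row j P.
  by rewrite -row_mul e row_mul row_diag_mx -scalemxAl -rowE.
set r := row j P in rA *; set d := D 0 j in rA *.
have u : S + d%:M \in unitmx.
  rewrite -row_free_unit -kermx_eq0; apply/negP => /negP k0.
  have : eigenvalue S (- d) by rewrite /eigenvalue /eigenspace raddfN /= opprK.
  move/eigenvalueP => [v ev v0].
  suff : eigenvalue (map_mx (real_complex R) S) (- d)%:C%C.
    by move/Sp; rewrite ltcR oppr_gt0 ltNge ltW // D0.
  apply/eigenvalueP; exists (map_mx (real_complex R) v);
    last by rewrite map_mx_eq0.
  by rewrite -map_mxM ev map_mxZ.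
have H : (r *m S - d *: r) *m (S + d%:M) = 0.
  rewrite mulmxDr mulmxBl -mulmxA SS mulmxA rA -!scalemxAl rA.
  by rewrite mul_mx_scalar scalerBr addrA subrK scalerA subrr.
by apply/eqP; rewrite -subr_eq0 -[_ - _](mulmxK u) H mul0mx.
Qed.

Lemma principal_sqrtE A P (D : 'rV[R]_n) :
  P \in unitmx -> P *m A = diag_mx D *m P -> (forall j, 0 < D 0 j) ->
  principal_sqrt (A *m A) = A.
Proof.
move=> Pu e D0; rewrite /principal_sqrt; case: xgetP => [S _ /= hS|/(_ A) []].
  exact: (principal_sqrt_unique Pu e D0 hS).
split=> // z /(eigenvalue_diagonalized Pu e) [j ->].
by rewrite ltcR.
Qed.

Lemma inv_norm_sqr M v : sym_posdef M -> inv_norm M v ^+ 2 = quad (invmx M) v.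
Proof.
move=> hM; rewrite sqr_sqrtr //; have [_ H] := posdef_inv hM.
have [->|v0] := eqVneq v 0; last by rewrite ltW // H.
by rewrite /quad mulmx0 mxE.
Qed.

Lemma trace_mulmx_sum A S : \tr (A *m S) = \sum_i \sum_j A i j * S j i.
Proof. by apply: eq_bigr => i _; rewrite mxE. Qed.
End PositiveDefinite.

(** * Integrals transported along a map with a prescribed law *)

Section Law.
Local Open Scope classical_set_scope.
Local Open Scope ereal_scope.
Context d d' (T : measurableType d) (T' : measurableType d') (R : realType).
Context (P : probability T R) (X : T -> T') (Q : probability T' R).
Hypothesis mX : measurable_fun setT X.
Hypothesis PX : forall A, measurable A -> pushforward P X A = Q A.
(** [distribution] takes a bundled measurable function, whereas [X] carries its measurability as a
    separate hypothesis. *)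
Let mX_mixin := isMeasurableFun.Build _ _ _ _ _ mX.
Let mX_pack : {mfun _ >-> _} := HB.pack X mX_mixin.

Lemma ge0_integral_law (f : T' -> R) : measurable_fun setT f ->
  (forall y, 0 <= f y)%R -> \int[P]_x (f (X x))%:E = \int[Q]_y (f y)%:E.
Proof.
move=> mf f0; transitivity (\int[distribution P mX_pack]_y (f y)%:E).
  rewrite ge0_integral_distribution //.
  exact/measurable_EFinP.
by apply: eq_measure_integral => A mA _; exact: PX.
Qed.

Lemma integrable_law (f : T' -> R) : measurable_fun setT f ->
  Q.-integrable setT (EFin \o f) -> P.-integrable setT (fun x => (f (X x))%:E).
Proof.
move=> mf /integrableP [_ If]; apply/integrableP; split.
  by apply/measurable_EFinP; exact: measurableT_comp.
rewrite (ge0_integral_law (f := fun y => `|f y|%R)) //.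
exact: measurableT_comp.
Qed.

Lemma integral_law (f : T' -> R) : measurable_fun setT f ->
  Q.-integrable setT (EFin \o f) -> \int[P]_x (f (X x))%:E = \int[Q]_y (f y)%:E.
Proof.
move=> mf If; transitivity (\int[distribution P mX_pack]_y (f y)%:E).
  rewrite integral_distribution //; first exact/measurable_EFinP.
  exact: integrable_law.
by apply: eq_measure_integral => A mA _; exact: PX.
Qed.
End Law.

(** * Cramer-Wold: from cosines of linear forms to all measurable sets *)

Section CramerWold.
Local Open Scope classical_set_scope.

Lemma bounded_integrable d (T : measurableType d) (R : realType)
    (P : probability T R) (f : T -> R) (B : R) :
  measurable_fun setT f -> (forall x, `|f x| <= B) ->
  P.-integrable setT (EFin \o f).
Proof.
move=> mf fB; apply: (le_integrable measurableT (g := EFin \o cst B)) => //.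
- exact/measurable_EFinP.
- by move=> x _; rewrite /= lee_fin (le_trans (fB x)) // ler_norm.
- exact: finite_measure_integrable_cst.
Qed.

Context (R : realType) (n : nat).
Implicit Types (u : 'cV[R]_n) (f g : Rn R n -> R).

(* Pointwise limits must be uniformly bounded, so that dominated convergence
   applies along them. *)
Inductive trig_closure : (Rn R n -> R) -> Prop :=
| trig_cos u c : trig_closure (fun x => cos (linform u x + c))
| trig_lin a b f g : trig_closure f -> trig_closure g ->
    trig_closure (fun x => a * f x + b * g x)
| trig_lim (F : nat -> Rn R n -> R) f B : (forall k, trig_closure (F k)) ->
    (forall k x, `|F k x| <= B) -> (forall x, F k x @[k --> \oo] --> f x) ->
    trig_closure f.

Lemma linformE u (x : Rn R n) : linform u x = \sum_i u i 0 * tnth x i.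
Proof. by rewrite /linform mxE; apply: eq_bigr => i _; rewrite !mxE. Qed.

Lemma measurable_linform u : measurable_fun setT (linform u).
Proof.
rewrite (_ : linform u = fun x => \sum_i u i 0 * tnth x i); last first.
  by apply/funext => x; rewrite linformE.
apply: measurable_sum => i; apply: measurable_funM => //.
exact: measurable_tnth.
Qed.

Lemma trig_closure_measurable f : trig_closure f -> measurable_fun setT f.
Proof.
elim=> {f} [u c|a b f g _ mf _ mg|F f B _ mF _ Ff].
- apply: (measurableT_comp (f := cos)).
    by apply: continuous_measurable_fun; exact: continuous_cos.
  by apply: measurable_funD => //; exact: measurable_linform.
- by apply: measurable_funD; apply: measurable_funM.
- by apply: (measurable_fun_cvg mF) => x _; exact: Ff.
Qed.

Lemma trig_closure_bounded f : trig_closure f -> exists B, forall x, `|f x| <= B.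
Proof.
elim=> {f} [u c|a b f g _ [B fB] _ [C gC]|F f B _ _ FB Ff].
- by exists 1 => x; exact: cos_max.
- exists (`|a| * B + `|b| * C) => x.
  by rewrite (le_trans (ler_normD _ _)) // !normrM lerD // ler_wpM2l.
- exists B => x; have Fx := cvg_norm (Ff x).
  by apply: (cvgr_to_le (Fx _)); near=> k; exact: FB.
Unshelve. all: by end_near. Qed.

Lemma trig_cst c : trig_closure (fun=> c).
Proof.
have := trig_lin c 0 (trig_cos 0 0) (trig_cos 0 0).
congr trig_closure; apply/funext => x.
by rewrite /linform trmx0 mul0mx mxE addr0 cos0 mulr1 mul0r addr0.
Qed.

Lemma trigZ a f : trig_closure f -> trig_closure (fun x => a * f x).
Proof.
move=> hf; have := trig_lin a 0 hf hf.
by congr trig_closure; apply/funext => x; rewrite mul0r addr0.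
Qed.

Lemma linformD u v x : linform (u + v) x = linform u x + linform v x.
Proof. by rewrite /linform linearD mulmxDl mxE. Qed.

Lemma linformN u x : linform (- u) x = - linform u x.
Proof. by rewrite /linform linearN mulNmx mxE. Qed.

(** Products turn the closure into an algebra, so that power series and intersections of sets become
    available. The base case is the product-to-sum formula; in a limit, boundedness of the other
    factor keeps the products uniformly bounded. *)
Lemma trigM f g : trig_closure f -> trig_closure g ->
  trig_closure (fun x => f x * g x).
Proof.
move=> hf; elim=> {g} [u c|a b g1 g2 _ h1 _ h2|F g B hF hM FB Fg].
- elim: hf => {f} [v d|a b f1 f2 _ h1 _ h2|F f B hF hM FB Ff].
  + have := trig_lin (1/2) (1/2) (trig_cos (v + u) (d + c))
      (trig_cos (v - u) (d - c)).
    congr trig_closure; apply/funext => x; rewrite !linformD linformN.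
    rewrite (_ : _ + (d + c) = (linform v x + d) + (linform u x + c)); last ring.
    rewrite (_ : _ + (d - c) = (linform v x + d) - (linform u x + c)); last ring.
    by rewrite cosD cosB; field.
  + have := trig_lin a b h1 h2.
    by congr trig_closure; apply/funext => x; ring.
  + apply: (trig_lim (B := B) hM) => [k x|x].
      by rewrite normrM -[B]mulr1 ler_pM // cos_max.
    by apply: cvgM => //; exact: cvg_cst.
- have := trig_lin a b h1 h2.
  by congr trig_closure; apply/funext => x; ring.
- have [C fC] := trig_closure_bounded hf.
  apply: (trig_lim (B := C * B) hM) => [k x|x].
    by rewrite normrM ler_pM.
  by apply: cvgM => //; exact: cvg_cst.
Qed.

Lemma trigX f k : trig_closure f -> trig_closure (fun x => f x ^+ k).
Proof.
move=> hf; elim: k => [|k IH]; first exact: trig_cst.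
by have := trigM hf IH; congr trig_closure; apply/funext => x; rewrite exprS.
Qed.

(** If [B] bounds [f], all partial sums of the exponential series are bounded by [expR |B|], as
    [trig_lim] demands. *)
Lemma trig_expR f : trig_closure f -> trig_closure (fun x => expR (f x)).
Proof.
move=> hf; have [B fB] := trig_closure_bounded hf.
apply: (trig_lim (F := fun k x => series (exp_coeff (f x)) k) (B := expR `|B|)).
- elim=> [|k IH].
    by have := trig_cst 0; congr trig_closure; apply/funext => x;
      rewrite /series /= big_geq.
  have := trig_lin 1 (k`!%:R^-1) IH (trigX k hf).
  congr trig_closure; apply/funext => x.
  by rewrite /series /= big_nat_recr //= mul1r mulrC.
- move=> k x; rewrite /series /=.
  apply: le_trans (ler_norm_sum _ _ _) _.
  apply: (@le_trans _ _ (series (exp_coeff `|B|) k)).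
    apply: ler_sum => i _; rewrite /exp_coeff /= normrM normfV normr_nat normrX.
    rewrite ler_wpM2r // lerXn2r ?nnegrE //.
    by rewrite (le_trans (fB x)) // ler_norm.
  apply: nondecreasing_cvgn_le; last exact: is_cvg_series_exp_coeff.
  apply: nondecreasing_series => i _ _; exact: exp_coeff_ge0.
- by move=> x; exact: is_cvg_series_exp_coeff.
Qed.

(** With [K = k.+1], the exponent [K * expR (K * f x)] tends to 0 where [f x < 0] and is at least
    [K] elsewhere. The outer factor [K] is there for the points with [f x = 0]. *)
Lemma trig_indic_lt0 f : trig_closure f ->
  trig_closure (\1_[set x | f x < 0]).
Proof.
move=> hf.
apply: (trig_lim (B := 1)
  (F := fun k x => expR (- (k.+1%:R * expR (k.+1%:R * f x))))).
- move=> k; apply: trig_expR.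
  have := trigZ (- k.+1%:R) (trig_expR (trigZ k.+1%:R hf)).
  by congr trig_closure; apply/funext => x; rewrite mulNr.
- by move=> k x; rewrite ger0_norm ?expR_ge0 // -[leRHS]expR0 ler_expR oppr_le0.
move=> x; rewrite indicE; case: (ltP (f x) 0) => fx.
  rewrite mem_set //=.
  apply: (@squeeze_cvgr _ _ _ _
    (fun k => 1 - 2 / (f x ^+ 2) * harmonic k) (fun=> 1)).
  - near=> k; apply/andP; split; last first.
      rewrite -[leRHS]expR0 ler_expR oppr_le0 mulr_ge0 // expR_ge0 //.
    apply: le_trans (expR_ge1Dx _); rewrite lerD2l lerN2.
    have fx2 : 0 < f x ^+ 2 by rewrite exprn_even_gt0 //= lt_eqF.
    (* The quadratic lower bound on the exponential gives [e <= 2 / (K * f x)^2], which still tends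
       to 0 after multiplication by [K]; a linear bound would not. *)
    have := @expR_ge1Dxn _ (- (k.+1%:R * f x)) 1%N; rewrite expRN.
    set e := expR _ => H.
    have e0 : 0 < e by exact: expR_gt0.
    have k0 : 0 < k.+1%:R :> R by [].
    have {}H : (k.+1%:R * f x) ^+ 2 / 2 <= e^-1.
      rewrite -sqrrN; apply: le_trans (H _).
        by rewrite lerDr.
      by rewrite oppr_ge0 pmulr_rle0 // ltW.
    set K : R := k.+1%:R in k0 H *.
    have H' : e <= (((K * f x) ^+ 2) / 2)^-1.
      rewrite -[e]invrK lef_pV2 // posrE ?invr_gt0 //.
      by rewrite divr_gt0 // exprMn mulr_gt0 // exprn_gt0.
    apply: (le_trans (ler_wpM2l (ltW k0) H')).
    rewrite /harmonic /= -/K le_eqVlt; apply/orP; left; apply/eqP.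
    by clearbody K; field; rewrite (gt_eqF k0) (lt_eqF fx).
  - have : (1 : R) - 2 / f x ^+ 2 * harmonic k @[k --> \oo] -->
        1 - 2 / f x ^+ 2 * 0.
      apply: cvgB; first exact: cvg_cst.
      by apply: cvgM; [exact: cvg_cst|exact: cvg_harmonic].
    by rewrite mulr0 subr0.
  - exact: cvg_cst.
rewrite memNset /=; last by move=> /lt_geF; rewrite fx.
apply: (@squeeze_cvgr _ _ _ _ (fun=> 0) harmonic); last exact: cvg_harmonic.
  near=> k; rewrite expR_ge0 /= expRN /harmonic /=.
  rewrite lef_pV2 ?posrE ?expR_gt0 //.
  have k0 : 0 < k.+1%:R :> R by [].
  apply: (@le_trans _ _ (k.+1%:R * expR (k.+1%:R * f x))).
    by rewrite ler_peMr // ?(ltW k0) // -[leLHS]expR0 ler_expR mulr_ge0.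
  by apply: le_trans (expR_ge1Dx _); rewrite lerDr.
exact: cvg_cst.
Unshelve. all: by end_near. Qed.

(* For large [k] the sign of [sin (y / k)] is that of [y]. *)
Lemma trig_indic_coordinate_lt i (a : R) :
  trig_closure (\1_[set x | tnth x i < a]).
Proof.
pose s k (x : Rn R n) := sin ((tnth x i - a) / k.+1%:R).
apply: (trig_lim (B := 1) (F := fun k => \1_[set x | s k x < 0])).
- move=> k; apply: trig_indic_lt0.
  have := trig_cos (k.+1%:R^-1 *: delta_mx i 0) (- a / k.+1%:R - pi / 2).
  congr trig_closure; apply/funext => x.
  rewrite addrA cosBpihalf /s linformE (bigD1 i) //= big1 ?addr0.
    by rewrite !mxE !eqxx mulr1; congr sin; rewrite mulrBl mulNr mulrC.
  by move=> j ji; rewrite !mxE (negbTE ji) andFb mulr0 mul0r.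
- by move=> k x; rewrite indicE; case: (_ \in _); rewrite ?normr1 ?normr0.
move=> x; apply: cvg_near_cst.
have : (tnth x i - a) * harmonic k @[k --> \oo] --> (tnth x i - a) * 0.
  by apply: cvgM; [exact: cvg_cst|exact: cvg_harmonic].
rewrite mulr0 => /cvgrPdist_lt /(_ pi (pi_gt0 R)) H.
near=> k.
have : `|0 - (tnth x i - a) * harmonic k| < pi by near: k.
rewrite sub0r normrN /harmonic /= ltr_norml => /andP[h1 h2].
have k0 : 0 < k.+1%:R^-1 :> R by rewrite invr_gt0.
rewrite !indicE; congr (nat_of_bool _)%:R.
apply/idP/idP; rewrite !inE /= /s; last first.
  move=> xa; rewrite -oppr_gt0 -sinN; apply: sin_gt0_pi; rewrite ltrNl h1 andbT.
  by rewrite oppr_gt0 pmulr_llt0 // subr_lt0.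
rewrite ltNge (ltNge _ a); apply: contraNN => ax.
by apply: sin_ge0_pi; rewrite (ltW h2) mulr_ge0 ?subr_ge0 // ltW.
Unshelve. all: by end_near. Qed.

Lemma trig_indicC (A : set (Rn R n)) :
  trig_closure (\1_A) -> trig_closure (\1_(~` A)).
Proof.
move=> hA; have := trig_lin 1 (-1) (trig_cst 1) hA.
congr trig_closure; apply/funext => x; rewrite !indicE in_setC.
by case: (_ \in _) => /=; ring.
Qed.

Lemma trig_indicI (A B : set (Rn R n)) :
  trig_closure (\1_A) -> trig_closure (\1_B) -> trig_closure (\1_(A `&` B)).
Proof.
move=> hA hB; have := trigM hA hB.
congr trig_closure; apply/funext => x; rewrite !indicE in_setI.
by case: (_ \in _) => /=; rewrite ?mul1r ?mul0r.
Qed.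

(** Finite unions come from complements and intersections. Along them the indicator at a fixed point
    is eventually constant. *)
Lemma trig_indic_bigcup (A : (set (Rn R n))^nat) :
  (forall k, trig_closure (\1_(A k))) -> trig_closure (\1_(\bigcup_k A k)).
Proof.
move=> hA.
have hI k : trig_closure (\1_(\bigcup_(j < k) A j)).
  elim: k => [|k IH].
    rewrite bigcup_mkord big_ord0; have := trig_cst 0.
    by congr trig_closure; apply/funext => x; rewrite indicE in_set0.
  rewrite bigcup_mkord big_ord_recr /= -bigcup_mkord -[_ `|` _]setCK setCU.
  by apply/trig_indicC/trig_indicI; exact: trig_indicC.
apply: (trig_lim (B := 1) hI) => [k x|x].
  by rewrite indicE; case: (_ \in _); rewrite ?normr1 ?normr0.
apply: cvg_near_cst; rewrite !indicE.
case: (pselect ((\bigcup_k A k) x)) => [[m _ Am]|nA].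
  near=> k.
  have mk : (m < k)%N by near: k; exact: nbhs_infty_gt.
  by rewrite indicE !mem_set //; exists m.
near=> k; rewrite indicE !memNset // => -[j _ Aj]; by apply: nA; exists j.
Unshelve. all: by end_near. Qed.

Lemma trig_indic_measurable (A : set (Rn R n)) :
  measurable A -> trig_closure (\1_A).
Proof.
have s0 : trig_closure (\1_set0).
  have := trig_cst 0; congr trig_closure; apply/funext => x.
  by rewrite indicE in_set0.
(* The sets with indicator in the closure form a sigma-algebra, so generators suffice: first
   preimages of Borel sets by a coordinate, then, by the same argument on the line, open rays. *)
move: A; apply: smallest_sub.
  split=> //= [B|F]; first by rewrite setTD; exact: trig_indicC.
  exact: trig_indic_bigcup.
move=> A; rewrite -bigcup_seq /= => -[i _ [B mB <-]]; rewrite setTI.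
have {mB} : (@ocitv R).-sigma.-measurable B by exact: mB.
rewrite RGenInftyO.measurableE; move: B; apply: smallest_sub.
  split=> [|B hB|F hF].
  - by rewrite /= preimage_set0.
  - by rewrite /= setTD preimage_setC; exact: trig_indicC.
  - by rewrite /= preimage_bigcup; exact: trig_indic_bigcup.
move=> _ [a ->] /=.
exact: trig_indic_coordinate_lt.
Qed.

(** Equality of integrals propagates through [trig_closure]: the cosine of a linear form sees only
    the law of that form, and limits pass by dominated convergence with the constant bound [B]. *)
Lemma cramer_wold (P P' : probability (Rn R n) R) :
  (forall u (A : set (measurableTypeR R)), measurable A ->
     pushforward P (linform u) A = pushforward P' (linform u) A) ->
  forall A, measurable A -> P A = P' A.
Proof.
move=> PP' A /[dup] mA /trig_indic_measurable hA.
suff H f : trig_closure f -> (\int[P]_x (f x)%:E = \int[P']_x (f x)%:E)%E.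
  have := H _ hA; rewrite !integral_indic // !setIT //.
have hI (Q : probability (Rn R n) R) g : trig_closure g ->
    Q.-integrable setT (EFin \o g).
  move=> hg; have [B gB] := trig_closure_bounded hg.
  exact: (bounded_integrable _ (trig_closure_measurable hg) gB).
elim=> {f} [u c|a b f g hf ef hg eg|F f B hF eF FB Ff].
- pose mixin := isMeasurableFun.Build _ _ _ _ _ (measurable_linform u).
  pose L : {mfun _ >-> _} := HB.pack (linform u) mixin.
  have mc : measurable_fun setT (fun y : measurableTypeR R => cos (y + c)).
    apply: (measurableT_comp (f := cos)).
      by apply: continuous_measurable_fun; exact: continuous_cos.
    exact: measurable_funD.
  have Ic : (distribution P' L).-integrable setT (EFin \o (fun y => cos (y + c))).
    exact: (bounded_integrable (distribution P' L) mc (fun y => cos_max (y + c))).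
  have mu : measurable_fun setT (linform u : _ -> measurableTypeR R).
    exact: measurable_linform.
  have e1 := @integral_law _ _ _ _ _ P (linform u) (distribution P' L)
    mu (PP' u) _ mc Ic.
  have e2 := @integral_law _ _ _ _ _ P' (linform u) (distribution P' L)
    mu (fun _ _ => erefl) _ mc Ic.
  by rewrite e1 e2.
- under eq_integral do rewrite EFinD !EFinM.
  under [RHS]eq_integral do rewrite EFinD !EFinM.
  have hZ (Q : probability (Rn R n) R) k h : trig_closure h ->
      Q.-integrable setT (fun x => k%:E * (h x)%:E)%E.
    by move=> hh; apply: integrableZl => //; exact: hI.
  rewrite !integralD //; do ?exact: hZ.
  rewrite !integralZl //; do ?exact: hI.
  by rewrite ef eg.
- have cv (Q : probability (Rn R n) R) :
    (\int[Q]_x (F k x)%:E @[k --> \oo] --> \int[Q]_x (f x)%:E)%E.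
    have hf := trig_lim hF FB Ff.
    apply: (dominated_cvg measurableT (g := EFin \o cst B)) => //.
    + by move=> k; apply/measurable_EFinP; exact: trig_closure_measurable.
    + by move=> x _; apply/cvg_EFin; [exact: nearW|exact: Ff].
    + exact: finite_measure_integrable_cst.
    + by move=> k x _; rewrite lee_fin.
  have := cv P; under eq_cvg do rewrite eF.
  move=> h; exact: (cvg_unique _ h (cv P')).
Qed.
End CramerWold.

(** * A normal law on the line is determined by its first two moments *)

Section NormalLaw.
Local Open Scope classical_set_scope.
Context (R : realType).
Local Notation leb := (@lebesgue_measure R).

(** The Radon-Nikodym derivative of the law and [normal_pdf] have the same integral over every
    measurable set, hence agree almost everywhere. *)
Lemma ge0_integral_normal_prob (m s : R) (h : measurableTypeR R -> R) :
  measurable_fun setT h -> (forall x, 0 <= h x) ->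
  (\int[normal_prob m s]_x (h x)%:E =
   \int[leb]_x (h x * normal_pdf m s x)%:E)%E.
Proof.
move=> mh h0; have dom := normal_prob_dominates m s.
have mE : measurable_fun setT (EFin \o h) by exact/measurable_EFinP.
rewrite -(Radon_Nikodym_SigmaFinite.change_of_variables dom) //.
under [RHS]eq_integral do rewrite EFinM.
have IRN := Radon_Nikodym_SigmaFinite.f_integrable dom.
have mpdf : measurable_fun setT
    (fun x : measurableTypeR R => (normal_pdf m s x)%:E).
  by apply/measurable_EFinP; exact: measurable_normal_pdf.
apply: ae_eq_integral => //.
- by apply: emeasurable_funM => //; exact: measurable_int IRN.
- exact: emeasurable_funM.
- apply: ae_eqe_mul2l; apply: integral_ae_eq => // E _ mE'.
  by rewrite -Radon_Nikodym_SigmaFinite.f_integral.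
Qed.

Lemma ge0_integral_lebesgueN (g : measurableTypeR R -> R) :
  measurable_fun setT g -> (forall x, 0 <= g x) ->
  (\int[leb]_x (g x)%:E = \int[leb]_x (g (- x))%:E)%E.
Proof.
move=> mg g0.
transitivity (\int[pushforward leb (-%R : _ -> measurableTypeR R)]_x (g x)%:E)%E.
  by apply: eq_measure_integral => A mA _; exact/esym/lebesgue_measureN.
rewrite ge0_integral_pushforward //=.
  exact/measurable_EFinP.
by move=> y _; rewrite lee_fin.
Qed.

(** Reduction to the standard law by [x = m + |s| z]. The sign of [s] is unconstrained; the absolute
    value makes the substitution increasing, and the density involves only [s ^+ 2]. *)
Lemma ge0_integral_normal_subst (m s : R) (h : R -> R) : s != 0 ->
  continuous h -> (forall x, 0 <= h x) ->
  (\int[normal_prob m s]_x (h x)%:E =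
   \int[leb]_z (h (m + `|s| * z) * normal_pdf 0 1 z)%:E)%E.
Proof.
move=> s0 ch h0; have mh : measurable_fun setT h.
  exact: continuous_measurable_fun.
rewrite (ge0_integral_normal_prob m s mh h0).
have sp : 0 < `|s| by rewrite normr_gt0.
pose F (z : R^o) : R := m + `|s| * z.
have dF z : derivable F z 1 by exact: derivableD.
have F'E : F^`()%classic = cst `|s|.
  apply/funext => z; rewrite derive1E /F deriveD // derive_cst add0r.
  by rewrite deriveM // derive_cst derive_id scaler0 addr0 /GRing.scale /= mulr1.
have homF : {homo F : x y / x < y} by move=> x y xy; rewrite /F ltrD2l ltr_pM2l.
have cF' : continuous F^`()%classic by rewrite F'E => ?; exact: cvg_cst.
have cN : cvg (F^`()%classic x @[x --> -oo%R]) by rewrite F'E; exact: is_cvg_cst.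
have cy : cvg (F^`()%classic x @[x --> +oo%R]) by rewrite F'E; exact: is_cvg_cst.
have FN : F x @[x --> -oo%R] --> -oo%R.
  apply/cvgrNyPle => A.
  apply: filterS (nbhs_ninfty_le (num_real ((A - m) / `|s|))) => z zA.
  by rewrite /F -lerBrDl mulrC -ler_pdivlMr.
have Fy : F x @[x --> +oo%R] --> +oo%R.
  apply/cvgryPge => A.
  apply: filterS (nbhs_pinfty_ge (num_real ((A - m) / `|s|))) => z zA.
  by rewrite /F -lerBlDl mulrC -ler_pdivrMr.
have cG : continuous (fun x => h x * normal_pdf m s x).
  by move=> x; apply: cvgM; [exact: ch|exact: continuous_normal_pdf].
have G0 x : 0 <= h x * normal_pdf m s x by rewrite mulr_ge0 // normal_pdf_ge0.
rewrite (increasing_ge0_integration_by_substitutionT homF cF' cN cy dF FN Fy cG G0).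
apply: eq_integral => z _; congr EFin; rewrite F'E.
transitivity (h (F z) * normal_pdf m s (F z) * `|s|); first by [].
rewrite -mulrA; congr (_ * _).
rewrite !normal_pdfE ?oner_eq0 // /normal_fun /normal_peak /F.
rewrite addrAC subrr add0r subr0 expr1n !mul1r mulrAC; congr (_ * expR _).
  rewrite -mulrnAr sqrtrM ?sqr_ge0 // sqrtr_sqr invfM mulrAC mulVf ?mul1r //.
  by rewrite gt_eqF.
rewrite exprMn real_normK ?num_real //; field; exact: s0.
Qed.

(* Only positivity of the standard second moment is needed, not its value 1. *)
Let Z2 : \bar R := (\int[leb]_z (z ^+ 2 * normal_pdf 0 1 z)%:E)%E.

Let measurable_Z2 :
  measurable_fun setT (fun z : measurableTypeR R => z ^+ 2 * normal_pdf 0 1 z).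
Proof.
apply: measurable_funM; first exact: measurable_funX.
exact: measurable_normal_pdf.
Qed.

(** Were the integral zero, the integrand would vanish off a null set; but it is positive on
    [[1, 2]], of length 1. *)
Let Z2_gt0 : (0 < Z2)%E.
Proof.
have Z2_ge0 : (0 <= Z2)%E.
  by apply: integral_ge0 => z _; rewrite lee_fin mulr_ge0 ?sqr_ge0 ?normal_pdf_ge0.
rewrite lt_neqAle Z2_ge0 andbT; apply/negP => /eqP Z0.
have mE := (measurable_EFinP _ _).2 measurable_Z2.
have := (ae_eq_integral_abs leb measurableT mE).1.
have -> : (\int[leb]_z `|(z ^+ 2 * normal_pdf 0 1 z)%:E| = 0)%E.
  rewrite Z0; apply: eq_integral => z _ /=.
  by rewrite ger0_norm // mulr_ge0 ?sqr_ge0 ?normal_pdf_ge0.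
move=> /(_ erefl) [N [mN N0 sub]].
have : (leb `[1%R, 2%R] <= leb N)%E.
  apply: le_measure; rewrite ?inE //.
  move=> z /=; rewrite in_itv /= => /andP[z1 _].
  apply: sub => /= /(_ I) [] /eqP; apply/negP.
  rewrite mulf_neq0 // ?expf_neq0 //; first by rewrite gt_eqF // (lt_le_trans _ z1).
  rewrite normal_pdfE ?oner_eq0 // mulf_neq0 // gt_eqF ?expR_gt0 //.
  by rewrite normal_peak_gt0 ?oner_eq0.
rewrite lebesgue_measure_itv /= lte_fin ltr1n N0 -EFinD lee_fin.
by rewrite (_ : 2 - 1 = 1 :> R) ?ler10 //; lra.
Qed.

Section Variable_with_normal_law.
Context d (T : measurableType d) (P : probability T R).
Variables (X : T -> R) (m s : R).
Hypothesis mX : measurable_fun setT (X : T -> measurableTypeR R).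
Hypothesis lawX : forall A : set (measurableTypeR R), measurable A ->
  pushforward P X A = normal_law m s A.

Lemma ge0_integral_normal_law (h : R -> R) :
  continuous h -> (forall x, 0 <= h x) ->
  (\int[P]_x (h (X x))%:E =
   if s == 0%R then (h m)%:E
   else \int[leb]_z (h (m + `|s| * z) * normal_pdf 0 1 z)%:E)%E.
Proof.
move=> ch h0; have mh : measurable_fun setT (h : measurableTypeR R -> R).
  exact: continuous_measurable_fun.
move: lawX; rewrite /normal_law; case: eqVneq => s0 law.
  have -> := @ge0_integral_law _ _ _ (measurableTypeR R) _ P X
    (\d_(m : measurableTypeR R)) mX law h mh h0.
  rewrite integral_dirac //; last exact/measurable_EFinP.
  by rewrite diracT mul1e.
have -> := @ge0_integral_law _ _ _ (measurableTypeR R) _ P X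
  (normal_prob m s) mX law h mh h0.
exact: ge0_integral_normal_subst.
Qed.

Let sqc (a : R) : continuous (fun x : R => (x - a) ^+ 2).
Proof.
move=> x; apply: (@continuous_comp _ _ _ (fun x => x - a) (fun x => x ^+ 2)).
  by apply: cvgB; [exact: cvg_id|exact: cvg_cst].
exact: exprn_continuous.
Qed.

Lemma normal_law_sqdev :
  (\int[P]_x ((X x - m) ^+ 2)%:E = (s ^+ 2)%:E * Z2)%E.
Proof.
rewrite (ge0_integral_normal_law (@sqc m)); last by move=> x; rewrite sqr_ge0.
case: eqVneq => [->|s0]; first by rewrite subrr expr0n mul0e.
rewrite /Z2 -ge0_integralZl_EFin //.
- apply: eq_integral => z _; rewrite -EFinM addrAC subrr add0r exprMn.
  by rewrite real_normK ?num_real // -mulrA.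
- by move=> z _; rewrite lee_fin mulr_ge0 ?sqr_ge0 ?normal_pdf_ge0.
- exact/measurable_EFinP.
- exact: sqr_ge0.
Qed.

(** The standard density is even, so the law is invariant under reflection about [m]. This is what
    ties the parameter [m] to the mean. *)
Lemma normal_law_sym (h : R -> R) : continuous h -> (forall x, 0 <= h x) ->
  (\int[P]_x (h (X x))%:E = \int[P]_x (h (2 * m - X x)%R)%:E)%E.
Proof.
move=> ch h0; rewrite (ge0_integral_normal_law ch h0).
have ch' : continuous (fun x => h (2 * m - x)).
  move=> x; apply: (@continuous_comp _ _ _ (fun x => 2 * m - x) h); last exact: ch.
  by apply: cvgB; [exact: cvg_cst|exact: cvg_id].
rewrite (ge0_integral_normal_law (h := fun x => h (2 * m - x)) ch') //.
case: eqVneq => [_|s0]; first by congr (h _)%:E; ring.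
rewrite ge0_integral_lebesgueN.
- apply: eq_integral => z _; congr (h _ * _)%:E; first ring.
  by rewrite !normal_pdfE ?oner_eq0 // /normal_fun !subr0 sqrrN.
- apply: measurable_funM; last exact: measurable_normal_pdf.
  apply: (measurableT_comp (f := h)); first exact: continuous_measurable_fun.
  by apply: measurable_funD => //; exact: measurable_funM.
- by move=> z; rewrite mulr_ge0 ?normal_pdf_ge0.
Qed.

Lemma normal_law_moments (e V : R) :
  P.-integrable setT (fun x => (X x)%:E) ->
  P.-integrable setT (fun x => (X x ^+ 2)%:E) ->
  (\int[P]_x (X x)%:E = e%:E)%E -> (\int[P]_x (X x ^+ 2)%:E = V%:E)%E ->
  m = e /\ ((V - m ^+ 2)%:E = (s ^+ 2)%:E * Z2)%E.
Proof.
move=> iX iX2 EX EX2.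
have sqE a : (\int[P]_x ((X x - a) ^+ 2)%:E = (V - 2 * a * e + a ^+ 2)%:E)%E.
  under eq_integral => x _.
    rewrite (_ : ((X x - a) ^+ 2)%:E =
      ((X x ^+ 2)%:E + (- (2 * a))%:E * (X x)%:E) + (a ^+ 2)%:E)%E.
      by over.
    by rewrite -EFinM -!EFinD; congr EFin; ring.
  have Ea : (\int[P]_x (a ^+ 2)%:E = (a ^+ 2)%:E)%E.
    by have := expectation_cst P (a ^+ 2); rewrite unlock.
  have i1 : P.-integrable setT (fun x => (- (2 * a))%:E * (X x)%:E)%E.
    exact: integrableZl.
  rewrite integralD //; last 2 first.
  - exact: integrableD.
  - exact: finite_measure_integrable_cst.
  rewrite integralD // integralZl // EX EX2 Ea.
  by rewrite -EFinM -!EFinD; congr EFin; ring.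
have me : m = e.
  (* The symmetry is stated for nonnegative functions, so it is tested on a square centred off [m].
     Reflection moves the centre from [m + 1] to [m - 1], and the two integrals differ by
     [4 (m - e)]. *)
  have := normal_law_sym (@sqc (m + 1)) (fun x => sqr_ge0 _).
  under [RHS]eq_integral => x _.
    rewrite (_ : (2 * m - X x - (m + 1)) ^+ 2 = (X x - (m - 1)) ^+ 2); last ring.
    by over.
  by rewrite !sqE => -[]; lra.
split=> //; rewrite -normal_law_sqdev sqE -me; congr EFin; ring.
Qed.
End Variable_with_normal_law.

Lemma normal_law_determined d1 d2 (T1 : measurableType d1) (T2 : measurableType d2)
    (P1 : probability T1 R) (P2 : probability T2 R)
    (X1 : T1 -> R) (X2 : T2 -> R) (m1 s1 m2 s2 e V : R) :
  measurable_fun setT (X1 : T1 -> measurableTypeR R) ->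
  measurable_fun setT (X2 : T2 -> measurableTypeR R) ->
  (forall A : set (measurableTypeR R), measurable A ->
     pushforward P1 X1 A = normal_law m1 s1 A) ->
  (forall A : set (measurableTypeR R), measurable A ->
     pushforward P2 X2 A = normal_law m2 s2 A) ->
  P1.-integrable setT (fun x => (X1 x)%:E) ->
  P1.-integrable setT (fun x => (X1 x ^+ 2)%:E) ->
  P2.-integrable setT (fun x => (X2 x)%:E) ->
  P2.-integrable setT (fun x => (X2 x ^+ 2)%:E) ->
  (\int[P1]_x (X1 x)%:E = e%:E)%E -> (\int[P1]_x (X1 x ^+ 2)%:E = V%:E)%E ->
  (\int[P2]_x (X2 x)%:E = e%:E)%E -> (\int[P2]_x (X2 x ^+ 2)%:E = V%:E)%E ->
  forall A : set (measurableTypeR R), measurable A ->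
    pushforward P1 X1 A = pushforward P2 X2 A.
Proof.
move=> mX1 mX2 law1 law2 iX1 iY1 iX2 iY2 E1 V1 E2 V2 A mA.
have [me1 v1] := normal_law_moments mX1 law1 iX1 iY1 E1 V1.
have [me2 v2] := normal_law_moments mX2 law2 iX2 iY2 E2 V2.
have em : m1 = m2 by rewrite me1.
rewrite (law1 _ mA) (law2 _ mA) em /normal_law.
have : ((s1 ^+ 2)%:E * Z2 = (s2 ^+ 2)%:E * Z2)%E by rewrite -v1 -v2 em.
(* Since [Z2] is positive, equal variances make both laws Dirac masses or neither. *)
have s2Z (s : R) : ((s ^+ 2)%:E * Z2 == 0)%E = (s == 0).
  by rewrite mule_eq0 (gt_eqF Z2_gt0) orbF eqe sqrf_eq0.
move=> eZ; have := s2Z s1; rewrite eZ s2Z => <-.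
case: (eqVneq s2 0) => [_|s20]; first by [].
(* Finiteness of [Z2] is read off the finite variance of [X2], as [s2] is nonzero here; it allows
   cancelling [Z2]. *)
have Zfin : Z2 \is a fin_num.
  have := v2; case: (Z2) Z2_gt0 => [r||] //.
  by rewrite gt0_muley // lte_fin exprn_even_gt0.
move: eZ; rewrite -(fineK Zfin) -!EFinM => -[] /mulIf => /(_ _) es.
have {}es : s1 ^+ 2 = s2 ^+ 2.
  by apply: es; rewrite gt_eqF // fine_gt0 // Z2_gt0 ltey_eq Zfin.
rewrite /normal_prob /normal_pdf.
have -> : (s1 == 0) = (s2 == 0) by rewrite -sqrf_eq0 es sqrf_eq0.
by rewrite /normal_peak /normal_fun es.
Qed.
End NormalLaw.

(** * Integrability and expectation of linear and quadratic forms *)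

Section SecondMoments.
Local Open Scope classical_set_scope.
Context (R : realType) (n : nat) (P : probability (Rn R n) R) (S : 'M[R]_n).
Hypotheses (hmean : has_mean 0 P) (hcov : has_covariance S P).

Let mcoord (i : 'I_n) : measurable_fun setT (fun x : Rn R n => tnth x i).
Proof. exact: measurable_tnth. Qed.

Let mcoord2 (i j : 'I_n) :
  measurable_fun setT (fun x : Rn R n => (tnth x i * tnth x j)%:E).
Proof. by apply/measurable_EFinP; apply: measurable_funM; exact: mcoord. Qed.

Lemma integral_coordinateM i j :
  (\int[P]_x (tnth x i * tnth x j)%:E = (S i j)%:E)%E.
Proof.
have := hcov i j; rewrite unlock !hmean !mxE /= unlock => <-.
apply: eq_integral => x _; congr EFin.
by rewrite -[LHS]/(tnth x i * tnth x j) -{1}[tnth x i]subr0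
  -{1}[tnth x j]subr0.
Qed.

(** [has_covariance] only gives values of integrals. On the diagonal the integrand is nonnegative,
    so a finite value means integrability; products and coordinates follow by domination, from
    [|a b| <= a^2 + b^2] and [|a| <= 1 + a^2]. *)
Let integrable_sqr i : P.-integrable setT (fun x => (tnth x i * tnth x i)%:E).
Proof.
apply/integrableP; split => //.
under eq_integral do rewrite /= ger0_norm -?expr2 ?sqr_ge0 // expr2.
by rewrite integral_coordinateM ltry.
Qed.

Lemma integrable_coordinateM i j :
  P.-integrable setT (fun x => (tnth x i * tnth x j)%:E).
Proof.
apply: (le_integrable measurableT _ _
  (integrableD measurableT (integrable_sqr i) (integrable_sqr j))) => //.
move=> x _ /=; rewrite lee_fin.
set a := tnth x i; set b := tnth x j.
have h : 0 <= a * a + b * b by rewrite addr_ge0 // -expr2 sqr_ge0.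
rewrite (ger0_norm h) ler_norml.
have := sqr_ge0 (a + b); have := sqr_ge0 (a - b); nra.
Qed.

Lemma integrable_coordinate i : P.-integrable setT (fun x => (tnth x i)%:E).
Proof.
apply: (le_integrable measurableT _ _ (integrableD measurableT
  (finite_measure_integrable_cst P 1 measurableT) (integrable_sqr i))) => //.
  apply/measurable_EFinP; exact: mcoord.
move=> x _ /=; rewrite lee_fin.
set a := tnth x i.
have h : 0 <= 1 + a * a by rewrite addr_ge0 // -expr2 sqr_ge0.
rewrite (ger0_norm h) ler_norml.
have := sqr_ge0 (a + 1); have := sqr_ge0 (a - 1); nra.
Qed.

Lemma integral_coordinate i : (\int[P]_x (tnth x i)%:E = 0)%E.
Proof. by have := hmean i; rewrite unlock mxE. Qed.

Lemma quad_colvE A (x : Rn R n) :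
  (quad A (colv x))%:E = (\sum_i \sum_j (A i j)%:E * (tnth x i * tnth x j)%:E)%E.
Proof.
rewrite quadE -sumEFin; apply: eq_bigr => i _; rewrite -sumEFin.
by apply: eq_bigr => j _; rewrite !mxE EFinM.
Qed.

Let integrable_term A i j :
  P.-integrable setT (fun x => (A i j : R)%:E * (tnth x i * tnth x j)%:E)%E.
Proof. by apply: integrableZl => //; exact: integrable_coordinateM. Qed.

Lemma integrable_quad A : P.-integrable setT (fun x => (quad A (colv x))%:E).
Proof.
under eq_fun do rewrite quad_colvE.
by apply: integrable_sum => // i _; apply: integrable_sum => // j _.
Qed.

Lemma integral_quad A : (\int[P]_x (quad A (colv x))%:E = (\tr (A *m S^T))%:E)%E.
Proof.
under eq_integral do rewrite quad_colvE.
rewrite integral_sum //; last first.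
  by move=> i; apply: integrable_sum => // j _.
rewrite trace_mulmx_sum -sumEFin; apply: eq_bigr => i _.
rewrite integral_sum // -sumEFin; apply: eq_bigr => j _.
rewrite integralZl //; last exact: integrable_coordinateM.
by rewrite integral_coordinateM mxE EFinM.
Qed.

Lemma linform_colvE u (x : Rn R n) :
  (linform u x)%:E = (\sum_i (u i 0)%:E * (tnth x i)%:E)%E.
Proof. by rewrite linformE -sumEFin; apply: eq_bigr => i _; rewrite EFinM. Qed.

Let integrable_lterm (u : 'cV[R]_n) i :
  P.-integrable setT (fun x => (u i 0)%:E * (tnth x i)%:E)%E.
Proof. by apply: integrableZl => //; exact: integrable_coordinate. Qed.

Lemma integrable_linform u : P.-integrable setT (fun x => (linform u x)%:E).
Proof.
under eq_fun do rewrite linform_colvE.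
by apply: integrable_sum => // i _.
Qed.

Lemma integral_linform u : (\int[P]_x (linform u x)%:E = 0)%E.
Proof.
under eq_integral do rewrite linform_colvE.
rewrite integral_sum // big1 // => i _.
rewrite integralZl //; last exact: integrable_coordinate.
by rewrite integral_coordinate mule0.
Qed.

Lemma linform_sqr u (x : Rn R n) : linform u x ^+ 2 = quad (u *m u^T) (colv x).
Proof.
rewrite /quad mulmxA -(mulmxA _ (u^T)) mxE big_ord1 expr2; congr (_ * _).
by rewrite /linform -[u^T *m colv x]mxtr11 trmx_mul trmxK.
Qed.

End SecondMoments.

(** * Lower bound for all couplings, and the coupling carried by a linear map *)

Section Coupling.
Local Open Scope classical_set_scope.
Context (R : realType) (n : nat).
Implicit Types (A : 'M[R]_n).

Definition linmap A (x : Rn R n) : Rn R n := [tuple (A *m colv x) i 0 | i < n].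

Lemma colv_linmap A x : colv (linmap A x) = A *m colv x.
Proof. by apply/colP => i; rewrite mxE tnth_mktuple. Qed.

Lemma linform_linmap A u x : linform u (linmap A x) = linform (A^T *m u) x.
Proof. by rewrite /linform colv_linmap trmx_mul trmxK mulmxA. Qed.

Lemma measurable_linmap A : measurable_fun setT (linmap A).
Proof.
apply/measurable_fun_tnthP => i.
rewrite (_ : _ \o _ = linform (row i A)^T); first exact: measurable_linform.
apply/funext => x /=; rewrite tnth_mktuple /linform trmxK -row_mul.
by rewrite [RHS]mxE.
Qed.

(** The form [u] of the image is the form [A^T u] under [P]. It and the form [u] under [P'] are
    normal with mean 0 and second moment [quad S' u], which fixes their common law. *)
Lemma gaussian_image A (S S' : 'M[R]_n) (P P' : probability (Rn R n) R) :
  S^T = S -> A *m S *m A^T = S' -> gaussian_with 0 S P -> gaussian_with 0 S' P' ->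
  forall B, measurable B -> pushforward P (linmap A) B = P' B.
Proof.
move=> Ss ASA [gP mP cP] [gP' mP' cP'].
pose mixin := isMeasurableFun.Build _ _ (Rn R n) (Rn R n) _ (measurable_linmap A).
pose L : {mfun Rn R n >-> Rn R n} := HB.pack (linmap A) mixin.
have S's : S'^T = S' by rewrite -ASA !trmx_mul trmxK Ss mulmxA.
apply: (@cramer_wold _ _ (distribution P L) P') => u B mB.
have -> : pushforward (distribution P L) (linform u) B =
    pushforward P (linform (A^T *m u)) B.
  rewrite /pushforward /distribution /pushforward; congr (P _).
  by apply/funext => x /=; rewrite linform_linmap.
have [m [s law]] := gP (A^T *m u); have [m' [s' law']] := gP' u.
have mL v : measurable_fun setT (linform v : Rn R n -> measurableTypeR R).
  exact: measurable_linform.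
have sqE : (fun v (x : Rn R n) => (linform v x ^+ 2)%:E) =
    (fun v (x : Rn R n) => (quad (v *m v^T) (colv x))%:E).
  by apply/funext => v; apply/funext => x; rewrite linform_sqr.
have E2 (S0 : 'M[R]_n) Q v : has_mean 0 Q -> has_covariance S0 Q ->
    S0^T = S0 -> (\int[Q]_x (linform v x ^+ 2)%:E = (quad S0 v)%:E)%E.
  move=> mQ cQ S0s; under eq_integral do rewrite linform_sqr.
  rewrite (integral_quad mQ cQ) S0s /quad; congr EFin.
  by rewrite -mulmxA mxtrace_mulC /mxtrace big_ord1.
have I2 (S0 : 'M[R]_n) Q v : has_mean 0 Q -> has_covariance S0 Q ->
    Q.-integrable setT (fun x => (linform v x ^+ 2)%:E).
  move=> mQ cQ; under eq_fun do rewrite linform_sqr.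
  exact: integrable_quad mQ cQ _.
apply: (normal_law_determined (mL _) (mL _) law law' (e := 0) (V := quad S' u)) => //.
- exact: integrable_linform mP cP _.
- exact: I2 mP cP.
- exact: integrable_linform mP' cP' _.
- exact: I2 mP' cP'.
- exact: integral_linform mP cP _.
- by rewrite (E2 _ _ _ mP cP Ss) -ASA -{2}[A]trmxK quad_congr.
- exact: integral_linform mP' cP' _.
- exact: E2 mP' cP' S's.
Qed.

Lemma quadB A (x y : 'cV[R]_n) : A^T = A ->
  quad A (x - y) = quad A x + quad A y - 2 * (x^T *m A *m y) 0 0.
Proof.
move=> As; have tB : (x - y)^T = x^T - y^T by exact: linearB.
have mB (a b : 'M[R]_1) : (a - b) 0 0 = a 0 0 - b 0 0 by rewrite !mxE.
rewrite /quad tB mulmxBr !mulmxBl !mB (bilinC y x As); ring.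
Qed.

(* The Fenchel-Young inequality for [quad G] and its conjugate, which is an
   equality exactly when [G x = Q y]. *)
Lemma quad_young G Q (x y : 'cV[R]_n) : sym_posdef G -> Q^T = Q ->
  quad (Q - G) x + quad (Q - Q *m invmx G *m Q) y <= quad Q (x - y).
Proof.
move=> hG Qs; have [Gs Gp] := hG; have Gu := posdef_unit hG.
(* Completing the square: the right side minus the left side is [quad G (x - w)]. *)
pose w := invmx G *m Q *m y.
have : 0 <= quad G (x - w).
  have [->|z0] := eqVneq (x - w) 0; first by rewrite /quad mulmx0 mxE.
  exact: ltW (Gp _ z0).
have e1 : quad G w = quad (Q *m invmx G *m Q) y.
  by rewrite -quad_congr trmx_mul trmx_inv Gs Qs mulmxKV // mulmxA.
have e2 : x^T *m G *m w = x^T *m Q *m y.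
  by rewrite -mulmxA /w -[invmx G *m Q *m y]mulmxA mulKVmx // mulmxA.
have quadBl (A B : 'M[R]_n) v : quad (A - B) v = quad A v - quad B v.
  by rewrite /quad mulmxBr mulmxBl !mxE.
rewrite !quadB // !quadBl e1 e2; lra.
Qed.

Lemma measurable_quad_sub Q : measurable_fun setT
  (fun z : Rn R n * Rn R n => quad Q (colv z.1 - colv z.2)).
Proof.
under eq_fun do rewrite quadE.
have mt i : measurable_fun setT
    (fun z : Rn R n * Rn R n => (colv z.1 - colv z.2) i 0).
  under eq_fun do rewrite !mxE.
  apply: measurable_funB.
    by apply: (measurableT_comp (measurable_tnth i)); exact: measurable_fst.
  by apply: (measurableT_comp (measurable_tnth i)); exact: measurable_snd.
apply: measurable_sum => i; apply: measurable_sum => j.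
by apply: measurable_funM => //; exact: measurable_funM.
Qed.

Lemma measurable_quad_colv A :
  measurable_fun setT (fun x : Rn R n => quad A (colv x)).
Proof.
under eq_fun do rewrite quadE.
apply: measurable_sum => i; apply: measurable_sum => j.
apply: measurable_funM => //; under eq_fun do rewrite !mxE.
by apply: measurable_funM; exact: measurable_tnth.
Qed.

Lemma coupling_cost_ge (mu nu : probability (Rn R n) R) pi (G Q X Y : 'M[R]_n) :
  sym_posdef G -> sym_posdef Q -> X^T = X -> Y^T = Y ->
  has_mean 0 mu -> has_covariance X mu -> has_mean 0 nu -> has_covariance Y nu ->
  coupling mu nu pi ->
  ((\tr ((Q - G) *m X) + \tr ((Q - Q *m invmx G *m Q) *m Y))%:E <=
   \int[pi]_z (quad Q (colv z.1 - colv z.2))%:E)%E.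
Proof.
move=> hG [Qs Qp] Xs Ys mmu cmu mnu cnu cpl.
have Q0 v : 0 <= quad Q v.
  have [->|v0] := eqVneq v 0; first by rewrite /quad mulmx0 mxE.
  exact: ltW (Qp _ v0).
pose f1 x : R := quad (Q - G) (colv x).
pose f2 y : R := quad (Q - Q *m invmx G *m Q) (colv y).
have law1 B : measurable B -> pushforward pi fst B = mu B.
  by move=> mB; have [] := cpl _ mB.
have law2 B : measurable B -> pushforward pi snd B = nu B.
  by move=> mB; have [] := cpl _ mB.
have m1 : measurable_fun setT f1 by exact: measurable_quad_colv.
have m2 : measurable_fun setT f2 by exact: measurable_quad_colv.
have I1 := integrable_quad mmu cmu (Q - G).
have I2 := integrable_quad mnu cnu (Q - Q *m invmx G *m Q).
have J1 := integrable_law measurable_fst law1 m1 I1.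
have J2 := integrable_law measurable_snd law2 m2 I2.
have e1 : (\int[pi]_z (f1 z.1)%:E = (\tr ((Q - G) *m X))%:E)%E.
  by rewrite (integral_law measurable_fst law1 m1 I1) (integral_quad mmu cmu) Xs.
have e2 : (\int[pi]_z (f2 z.2)%:E = (\tr ((Q - Q *m invmx G *m Q) *m Y))%:E)%E.
  by rewrite (integral_law measurable_snd law2 m2 I2) (integral_quad mnu cnu) Ys.
rewrite EFinD -e1 -e2 -integralD //.
have mc := (measurable_EFinP _ _).2 (measurable_quad_sub Q).
(* Monotonicity is applied between integrable functions, so a coupling of infinite cost, for which
   the bound is trivial, is set apart. *)
have [fin|] := ltP (\int[pi]_z (quad Q (colv z.1 - colv z.2))%:E)%E +oo%E;
  last first.
  by apply: le_trans; rewrite leey.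
apply: le_integral => //.
- exact: integrableD.
- apply/integrableP; split=> //.
  by under eq_integral do rewrite /= ger0_norm //.
- by move=> z _; rewrite -EFinD lee_fin; exact: quad_young.
Qed.

Lemma linmap_coupling A (S S' : 'M[R]_n) (P P' : probability (Rn R n) R) :
  S^T = S -> A *m S *m A^T = S' -> gaussian_with 0 S P -> gaussian_with 0 S' P' ->
  exists2 pi, coupling P P' pi &
    forall f : Rn R n * Rn R n -> R, measurable_fun setT f ->
    (forall z, 0 <= f z) ->
    (\int[pi]_z (f z)%:E = \int[P]_x (f (x, linmap A x))%:E)%E.
Proof.
move=> Ss ASA gP gP'.
have mg : measurable_fun setT (fun x => (x, linmap A x)).
  apply: measurable_fun_pair; first exact: measurable_id.
  exact: measurable_linmap.
pose mixin := isMeasurableFun.Build _ _ _ _ _ mg.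
pose g : {mfun Rn R n >-> (Rn R n * Rn R n)%type} :=
  HB.pack (fun x => (x, linmap A x)) mixin.
exists (distribution P g).
  by move=> B mB; split=> //; exact: gaussian_image Ss ASA gP gP' _ mB.
move=> f mf f0; rewrite ge0_integral_distribution //.
exact/measurable_EFinP.
Qed.
End Coupling.

Theorem proposition2 (R : realType) (n : nat) (M X Y : 'M[R]_n)
    (mu nu : probability (Rn R n) R)
    (hM : sym_posdef M) (hX : sym_posdef X) (hY : sym_posdef Y)
    (hmu : gaussian_with 0 X mu) (hnu : gaussian_with 0 Y nu) :
  gen_wasserstein2 M mu nu = (dgbw M X Y ^+ 2)%:E.
Proof.
have hQ := posdef_inv hM; set Q := invmx M in hQ *.
have Mu := posdef_unit hM; have [Ms _] := hM.
have [Xs _] := hX; have [Ys _] := hY; have [Qs Qp] := hQ.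
have Qu := posdef_unit hQ.
have hK : sym_posdef (Q *m Y *m Q) by have := posdef_congr Qu hY; rewrite Qs.
have [G [hG GXG [P [D [Pu eP D0]]]]] := posdef_riccati hX hK.
have [Gs _] := hG; have Gu := posdef_unit hG.
pose c := \tr (Q *m X) + \tr (Q *m Y) - 2 * \tr (X *m G).
have Q0 v : 0 <= quad Q v.
  have [->|v0] := eqVneq v 0; first by rewrite /quad mulmx0 mxE.
  exact: ltW (Qp _ v0).
have costE : (fun z => (inv_norm M (colv z.1 - colv z.2) ^+ 2)%:E) =
    (fun z : Rn R n * Rn R n => (quad Q (colv z.1 - colv z.2))%:E).
  by apply/funext => z; rewrite inv_norm_sqr.
have [_ mmu cmu] := hmu; have [_ mnu cnu] := hnu.
have [pi cpl Epi] : exists2 pi, coupling mu nu pi &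
    (\int[pi]_z (quad Q (colv z.1 - colv z.2))%:E = c%:E)%E.
  have TXT : (M *m G) *m X *m (M *m G)^T = Y.
    rewrite trmx_mul Gs Ms -!mulmxA (mulmxA X) (mulmxA G) (mulmxA G) GXG.
    by rewrite !mulmxA mulmxKV // mulmxV // mul1mx.
  have [pi cpl Epi] := linmap_coupling Xs TXT hmu hnu.
  exists pi => //; rewrite Epi //; last exact: measurable_quad_sub.
  pose N := (1%:M - M *m G)^T *m Q *m (1%:M - M *m G).
  transitivity (\int[mu]_x (quad N (colv x))%:E)%E.
    apply: eq_integral => x _; congr EFin.
    by rewrite quad_congr colv_linmap mulmxBl mul1mx.
  rewrite (integral_quad mmu cmu) Xs; congr EFin.
  (* Expanding [(1 - G M) Q (1 - M G)] with [M Q = 1]. The trace of [G M G X] becomes that of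
     [M (G X G) = Y Q] by cyclicity and the Riccati equation. *)
  have -> : N = Q - G - (G - G *m M *m G).
    have -> : N = (1%:M - G *m M) *m Q *m (1%:M - M *m G).
      by rewrite /N [(1%:M - _)^T]linearB /= trmx1 trmx_mul Gs Ms.
    rewrite mulmxBl mul1mx mulmxBr mulmx1 mulmxK // mulmxBl.
    by rewrite !mulmxA mulVmx // mul1mx.
  have tGMGX : \tr (G *m M *m G *m X) = \tr (Q *m Y).
    rewrite -!mulmxA mxtrace_mulC -!mulmxA (mulmxA G) GXG !mulmxA mulmxV //.
    by rewrite mul1mx mxtrace_mulC.
  by rewrite !mulmxBl !raddfB /= tGMGX (mxtrace_mulC G) /c; ring.
have EW : gen_wasserstein2 M mu nu = c%:E.
  apply/eqP; rewrite eq_le; apply/andP; split.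
    apply: ereal_inf_lbound; exists pi => //.
    by rewrite unlock /= costE.
  apply/ereal_infP => _ [pi' cpl' <-]; rewrite unlock costE.
  have := coupling_cost_ge hG hQ Xs Ys mmu cmu mnu cnu cpl'.
  rewrite (_ : _ + _ = c) //.
  (* By cyclicity this is the trace of [G^-1 (Q Y Q) = G^-1 (G X G)], so the lower bound equals [c]
     too. *)
  have tQGQY : \tr (Q *m invmx G *m Q *m Y) = \tr (X *m G).
    rewrite -!mulmxA mxtrace_mulC -!mulmxA (mulmxA Q Y) -GXG.
    by rewrite -!mulmxA mulKmx.
  by rewrite !mulmxBl !raddfB /= tQGQY (mxtrace_mulC G) /c; ring.
rewrite EW; congr EFin; rewrite /dgbw.
have -> : principal_sqrt (X *m Q *m Y *m Q) = X *m G.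
  rewrite -(principal_sqrtE Pu eP D0); congr principal_sqrt.
  by rewrite -!mulmxA (mulmxA G) GXG !mulmxA.
(* Squaring undoes [Num.sqrt] only on a nonnegative radicand; [c] is nonnegative as the expected
   cost of [pi]. *)
rewrite sqr_sqrtr // -/c -lee_fin -Epi.
by apply: integral_ge0 => z _; rewrite lee_fin.
Qed.
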